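(* The modulus of continuity of $A$ satisfies $$\omega(A,h)=\tfrac12h\log(1/h)+O(h)\qquad(0<h\le1).$$
   Context: $\{t\}$ is the fractional part of $t$, and $A(\lambda)=\int_0^\infty\{t\}\{\lambda t\}\,t^{-2}dt$ for $\lambda\ge0$. The modulus of continuity of $A$ on $[0,\infty)$ is $\omega(A,h)=\sup\{|A(x)-A(y)|:x,y\ge0,\ |x-y|\le h\}$. The constant implied by $O$ is absolute. *)

(* Defs.v *)
(* MathComp-Analysis world. *)
From HB Require Import structures.
From mathcomp Require Import all_boot all_order all_algebra.
From mathcomp Require Import all_classical all_reals all_analysis.
Set Implicit Arguments.
Unset Strict Implicit.
Unset Printing Implicit Defensive.
Import Order.TTheory GRing.Theory Num.Theory.
Import numFieldNormedType.Exports.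
Local Open Scope classical_set_scope.
Local Open Scope ring_scope.

Definition fracpart (R : realType) (t : R) : R := t - (Num.floor t)%:~R.

(* The integrand is nonnegative and, for l >= 0, at most min(l, t^-2); hence
   it is integrable and the real-valued integral carries no default value. *)
Definition autocorr (R : realType) (l : R) : R :=
  \int[@lebesgue_measure R]_(t in `]0, +oo[)
    (fracpart t * fracpart (l * t) * t ^- 2).

(* The supremum is taken in the extended reals, so that an unbounded family
   would give +oo rather than a default real value. *)
Definition modulus (R : realType) (f : R -> R) (h : R) : \bar R :=
  ereal_sup [set `|f p.1 - f p.2|%:E | p in
    [set p : R * R | [/\ 0 <= p.1, 0 <= p.2 & `|p.1 - p.2| <= h]]].

(* Main.v *)
Require Import Defs.
From HB Require Import structures.
From mathcomp Require Import all_boot all_order all_algebra.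
From mathcomp Require Import all_classical all_reals all_analysis.
From mathcomp Require Import measurable_realfun ring lra.
Import Order.TTheory GRing.Theory Num.Theory.
Import numFieldNormedType.Exports.
Local Open Scope classical_set_scope.
Local Open Scope ring_scope.
Set Implicit Arguments.
Unset Strict Implicit.

(** Write [e t = min (h t) 1] and let [x <= y <= x + h]. Since
    [{a + b} <= {a} + min b 1] for [b >= 0], we have [{y t} <= {x t} + e t]
    pointwise ([fracpartM_increment]). Both one-sided bounds on the increments
    of [A] come from this inequality.

    Increase. Multiplying by [{t} / t^2] and integrating gives
    [A y - A x <= \int_0^oo {t} e t / t^2] ([corr_increase]). Up to [O(h)] the
    right-hand side is [h * \int_1^(1/h) {t} / t]: the ranges [t <= 1] and
    [t >= 1/h] contribute [O(h)] each.

    Decrease. On [(0, 1)] the weight [{t}] is [t], and the dilation [u = x t]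
    turns [\int_0^1 {x t} / t dt] into [\int_0^x {u} / u du], which is
    nondecreasing in [x]; so this range does not contribute
    ([corr_near_le]). Beyond [1], writing [{t} = 1 - (1 - {t})] and using the
    pointwise inequality against the weight [1 - {t}] replaces the weight [{t}]
    by [1], at the cost of [\int_1^oo (1 - {t}) e t / t^2]
    ([corr_far_decrease]). With weight [1] the integral is
    [B x = \int_1^oo {x t} / t^2 dt = x * \int_x^oo {u} / u^2 du], for which
    [B x - B y <= y - x] ([far_integral_decrease]).

    What remains is that [{t}] and [1 - {t}] have the same mean: both
    [\int_1^T {t} / t] and [\int_1^T (1 - {t}) / t] are [(ln T) / 2 + O(1)].
    This is proved one unit interval at a time, where the deviation from half
    of the logarithm is [O(1 / k^2)] ([unit_mass_bounds]).

    The main term is attained between [0] and [h]: [A 0 = 0], and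
    [{h t} = h t] on [(1, 1/h)], hence [A h >= h * \int_1^(1/h) {t} / t]
    ([autocorr_ge]). *)

(** * Fractional parts *)

Section FractionalPart.
Context {R : realType}.
Implicit Types a b t : R.

Lemma fracpart_ge0 t : 0 <= fracpart t.
Proof. by rewrite subr_ge0 floor_le. Qed.

Lemma fracpart_lt1 t : fracpart t < 1.
Proof. by have := floorD1_gt t; rewrite /fracpart intrD ltrBlDl. Qed.

Lemma fracpart_le1 t : fracpart t <= 1.
Proof. exact/ltW/fracpart_lt1. Qed.

Lemma fracpart_le t : 0 <= t -> fracpart t <= t.
Proof. by move=> t0; rewrite gerBl ler0z floor_ge0. Qed.

Lemma fracpart0 : fracpart 0 = 0 :> R.
Proof. by rewrite /fracpart floor0 subr0. Qed.

Lemma fracpart_itv (k : nat) t : k%:R <= t < k.+1%:R -> fracpart t = t - k%:R.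
Proof.
move=> /andP[kt tk]; rewrite /fracpart (@floor_def _ _ (k%:Z)) //.
by rewrite -PoszD addn1 kt.
Qed.

Lemma fracpartD a b : 0 <= b -> fracpart (a + b) <= fracpart a + Num.min b 1.
Proof.
move=> b0; have := fracpart_lt1 (a + b); have := fracpart_ge0 a.
have : (Num.floor a)%:~R <= (Num.floor (a + b))%:~R :> R.
  by rewrite ler_int le_floor// lerDl.
by rewrite /fracpart; case: (leP b 1); lra.
Qed.

Lemma measurable_fracpart : measurable_fun setT (@fracpart R).
Proof.
apply: measurable_funB => //; apply: nondecreasing_measurable => // s t st.
by rewrite ler_int le_floor.
Qed.

(** The value at [0] is harmless: [inv] is continuous off a single point. *)
Lemma measurable_inv : measurable_fun setT (@GRing.inv R).
Proof.
have -> : setT = ~` [set 0] `|` [set 0 : R] by rewrite setUC setUv.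
apply/measurable_funU; [exact: measurableC| by []|split].
  apply: open_continuous_measurable_fun.
    by rewrite openC; exact: closed_eq.
  by move=> x /[!inE]/= /eqP; exact: inv_continuous.
exact: measurable_fun_set1.
Qed.

Lemma measurable_fracpartM a : measurable_fun setT (fun t => fracpart (a * t)).
Proof.
apply: (measurableT_comp measurable_fracpart).
exact: measurable_funM.
Qed.

Lemma measurable_invX n : measurable_fun setT (fun t : R => t ^- n).
Proof. exact: (measurableT_comp measurable_inv). Qed.

End FractionalPart.

(** * Integrals of nonnegative real functions *)

Section RealIntegrals.
Context {R : realType}.
Local Notation mu := (@lebesgue_measure R).
Implicit Types (D : set R) (f g : R -> R).
Local Open Scope ereal_scope.

Lemma integral_real_ge0 D f : (forall t, D t -> 0 <= f t)%R ->
  0 <= \int[mu]_(t in D) (f t)%:E.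
Proof. by move=> f0; apply: integral_ge0 => t /f0; rewrite lee_fin. Qed.

Lemma integral_real_le D f g : measurable D ->
  measurable_fun setT f -> measurable_fun setT g ->
  (forall t, D t -> 0 <= f t)%R -> (forall t, D t -> f t <= g t)%R ->
  \int[mu]_(t in D) (f t)%:E <= \int[mu]_(t in D) (g t)%:E.
Proof.
move=> mD mf mg f0 fg; apply: ge0_le_integral => //.
- by apply/measurable_EFinP; exact: measurable_funTS.
- by apply/measurable_EFinP; exact: measurable_funTS.
Qed.

Lemma integral_realD D f g : measurable D ->
  measurable_fun setT f -> measurable_fun setT g ->
  (forall t, D t -> 0 <= f t)%R -> (forall t, D t -> 0 <= g t)%R ->
  \int[mu]_(t in D) (f t + g t)%:E =
  \int[mu]_(t in D) (f t)%:E + \int[mu]_(t in D) (g t)%:E.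
Proof.
move=> mD mf mg f0 g0; rewrite -ge0_integralD//.
- by apply/measurable_EFinP; exact: measurable_funTS.
- by apply/measurable_EFinP; exact: measurable_funTS.
Qed.

Lemma integral_realZl D f (c : R) : measurable D ->
  measurable_fun setT f -> (forall t, D t -> 0 <= f t)%R -> (0 <= c)%R ->
  \int[mu]_(t in D) (c * f t)%:E = c%:E * \int[mu]_(t in D) (f t)%:E.
Proof.
move=> mD mf f0 c0; rewrite -ge0_integralZl_EFin//.
- by apply/measurable_EFinP; exact: measurable_funTS.
Qed.

Lemma integral_real_subset D1 D2 f : measurable D1 -> measurable D2 ->
  measurable_fun setT f -> (forall t, D2 t -> 0 <= f t)%R -> D1 `<=` D2 ->
  \int[mu]_(t in D1) (f t)%:E <= \int[mu]_(t in D2) (f t)%:E.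
Proof.
move=> mD1 mD2 mf f0 D12; apply: ge0_subset_integral => //.
- by apply/measurable_EFinP; exact: measurable_funTS.
Qed.

Lemma integral_real_split (a c : itv_bound R) (b : R) f :
  (a <= BRight b)%O -> (BRight b <= c)%O -> measurable_fun setT f ->
  (forall t, [set` Interval a c] t -> 0 <= f t)%R ->
  \int[mu]_(t in [set` Interval a c]) (f t)%:E =
  \int[mu]_(t in [set` Interval a (BRight b)]) (f t)%:E +
  \int[mu]_(t in [set` Interval (BRight b) c]) (f t)%:E.
Proof.
move=> ab bc mf f0; rewrite (@itv_bndbnd_setU _ _ a (BRight b) c)//.
rewrite ge0_integral_setU//.
- by apply/measurable_EFinP; exact: measurable_funTS.
- by rewrite -itv_bndbnd_setU// => t /f0; rewrite lee_fin.
- apply/disj_setPLR => t /=; rewrite !itv_boundlr => /andP[_ tb].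
  move: tb; rewrite bnd_simp => tb; apply/negP.
  by rewrite negb_and bnd_simp -leNgt tb.
Qed.

Lemma integral_real_eq_interior (a b : R) f g :
  measurable_fun setT f -> measurable_fun setT g ->
  (forall t, a < t < b -> f t = g t)%R ->
  \int[mu]_(t in `]a, b]) (f t)%:E = \int[mu]_(t in `]a, b]) (g t)%:E.
Proof.
move=> mf mg fg; rewrite [LHS]integral_itv_bndoo; last first.
  by apply/measurable_EFinP; exact: measurable_funTS.
rewrite [RHS]integral_itv_bndoo; last first.
  by apply/measurable_EFinP; exact: measurable_funTS.
by apply: eq_integral => t /[!inE]/=; rewrite in_itv/= => /fg ->.
Qed.

(** Dilating by [c] divides Lebesgue measure by [c]: the two measures agree on
    the half-open intervals, which determine a Borel measure. *)
Lemma integral_dilate D f (c : R) : (0 < c)%R -> measurable D ->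
  measurable_fun setT f -> (forall t, D t -> 0 <= f t)%R ->
  \int[mu]_(t in D) (f t)%:E =
  c%:E * \int[mu]_(t in (fun t => c * t)%R @^-1` D) (f (c * t)%R)%:E.
Proof.
move=> c0 mD mf f0.
have mc : measurable_fun setT ((fun t => c * t)%R : R -> measurableTypeR R).
  exact: measurable_funM.
have c0' : (0 <= c)%R by exact: ltW.
pose k : {nonneg R} := NngNum c0'.
have mfD : measurable_fun D (EFin \o f).
  by apply/measurable_EFinP; exact: measurable_funTS.
have f0' t : D t -> 0 <= (EFin \o f) t by move=> /f0; rewrite lee_fin.
transitivity (k%:num%:E *
  \int[pushforward mu ((fun t => c * t)%R : R -> measurableTypeR R)]_(t in D)
    (f t)%:E); last first.
  rewrite ge0_integral_pushforward//.
  by move=> t /[!inE] /f0'.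
rewrite -ge0_integral_mscale//.
apply: eq_measure_integral => A mA _.
apply: lebesgue_measure_unique => //= _ [[a b]] _ <-.
rewrite /mscale/= /pushforward/=.
have -> : (fun t => c * t)%R @^-1` `]a, b] =
    `](c^-1 * a)%R, (c^-1 * b)%R]%classic.
  apply/seteqP; split => t /=; rewrite !in_itv/= ![(c^-1 * _)%R]mulrC.
    by rewrite ltr_pdivrMr// ler_pdivlMr// mulrC.
  by rewrite ltr_pdivrMr// ler_pdivlMr// mulrC.
rewrite !lebesgue_measure_itv/= !lte_fin ltr_pM2l ?invr_gt0//.
case: ifP; last by rewrite mule0.
by rewrite -!EFinB -EFinM -mulrBr mulVKf ?gt_eqF.
Qed.

End RealIntegrals.

(** * Elementary antiderivatives *)

Section ElementaryIntegrals.
Context {R : realType}.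
Local Notation mu := (@lebesgue_measure R).

Lemma measurable_inv_affine (u v w : R) :
  measurable_fun setT (fun t : R => u + v / t + w * t).
Proof.
apply: measurable_funD; last exact: measurable_funM.
apply: measurable_funD => //; apply: measurable_funM => //.
exact: measurable_inv.
Qed.

(** This family of integrands contains [{t} / t] and [(1 - {t}) / t] on a unit
    interval, as well as the comparison functions used to estimate them. *)
Lemma integral_inv_affine (a b u v w : R) : 0 < a -> a < b ->
  (\int[mu]_(t in `]a, b]) (u + v / t + w * t)%:E =
   (u * (b - a) + v * (ln b - ln a) + w * ((b ^+ 2 - a ^+ 2) / 2))%:E)%E.
Proof.
move=> a0 ab.
pose f (t : R) := u + v / t + w * t.
pose F (t : R) := u * t + v * ln t + w / 2 * (t * t).
have dF (t : R) : 0 < t -> is_derive t (1 : R) F (f t).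
  move=> t0; have dln := is_derive1_ln t0.
  apply: is_derive_eq.
  by rewrite /f /GRing.scale/=; field; rewrite gt_eqF.
have df (t : R) : 0 < t -> {for t, continuous f}.
  move=> t0; have tn : t != 0 by rewrite gt_eqF.
  apply: cvgD; last by apply: cvgM; [exact: cvg_cst|exact: cvg_id].
  apply: cvgD; first exact: cvg_cst.
  by apply: cvgM; [exact: cvg_cst|exact: inv_continuous].
have mf : measurable_fun `]a, b[ (fun t => (f t)%:E).
  apply/measurable_EFinP; apply: measurable_funTS.
  exact: measurable_inv_affine.
rewrite (integral_itv_bndoo _ _ mf) -(integral_itv_bndoo true false mf).
have cF (t : R) : 0 < t -> {for t, continuous F}.
  move=> t0; apply/differentiable_continuous/derivable1_diffP.
  by case: (dF t t0).
rewrite (@continuous_FTC2 _ _ F)//.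
- by rewrite -EFinB; congr EFin; rewrite /F; field.
- apply: continuous_in_subspaceT => t /[!inE]/=; rewrite in_itv/= => /andP[at_ _].
  by apply: df; exact: lt_le_trans at_.
- split.
  + move=> t; rewrite in_itv/= => /andP[at_ _].
    by case: (dF t (lt_trans a0 at_)).
  + by apply: cvg_at_right_filter; exact: cF.
  + by apply: cvg_at_left_filter; apply: cF; exact: lt_trans ab.
- move=> t; rewrite in_itv/= => /andP[at_ _].
  by rewrite derive1E; have [_ ->] := dF t (lt_trans a0 at_).
Qed.

Lemma integral_invX2_tail (a : R) : 0 < a ->
  (\int[mu]_(t in `]a, +oo[) (t ^- 2)%:E = (a^-1)%:E)%E.
Proof.
move=> a0; rewrite integral_itv_obnd_cbnd; last first.
  by apply/measurable_EFinP; apply: measurable_funTS; exact: measurable_invX.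
have dF (t : R) : 0 < t -> is_derive t (1 : R) (fun x : R => - x^-1) (t ^- 2).
  move=> t0; have tn : t != 0 by rewrite gt_eqF.
  have := is_deriveV tn (is_derive_id t (1 : R)) => dV.
  apply: is_derive_eq.
  by rewrite /GRing.scale/= mulr1 opprK.
rewrite (@ge0_continuous_FTC2y _ _ (fun x => - x^-1) _ 0)//.
- by rewrite -EFinB sub0r opprK.
- by move=> t _; rewrite invr_ge0 sqr_ge0.
- apply: continuous_in_subspaceT => t /[!inE]/=; rewrite in_itv/= andbT => at_.
  have tn : t != 0 by rewrite gt_eqF// (lt_le_trans a0).
  apply: cvgV; first by rewrite expf_neq0.
  exact: exprn_continuous.
- rewrite -[X in _ --> X]oppr0; apply: cvgN; apply/gtr0_cvgV0.
    by near=> x; near: x; exact: nbhs_pinfty_gt.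
  exact: cvg_id.
- by move=> t at_; case: (dF t (lt_trans a0 at_)).
- apply: cvg_at_right_filter; apply: cvgN; apply: inv_continuous.
  by rewrite gt_eqF.
- move=> t; rewrite in_itv/= andbT => at_.
  by rewrite derive1E; have [_ ->] := dF t (lt_trans a0 at_).
Unshelve. all: by end_near. Qed.

End ElementaryIntegrals.

(** * The sawtooth against the logarithm *)

Section Sawtooth.
Context {R : realType}.
Local Notation mu := (@lebesgue_measure R).

Lemma measurable_fracpart_div :
  measurable_fun setT (fun t : R => fracpart t / t).
Proof.
by apply: measurable_funM; [exact: measurable_fracpart|exact: measurable_inv].
Qed.

Lemma measurable_cofracpart : measurable_fun setT (fun t : R => 1 - fracpart t).
Proof. by apply: measurable_funB => //; exact: measurable_fracpart. Qed.

Lemma measurable_cofracpart_div :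
  measurable_fun setT (fun t : R => (1 - fracpart t) / t).
Proof.
by apply: measurable_funM; [exact: measurable_cofracpart|exact: measurable_inv].
Qed.

(** The integral of [{t} / t = 1 - k / t] over [(k, k + 1)]. *)
Definition unit_mass (k : nat) : R := 1 - k%:R * (ln k.+1%:R - ln k%:R).

Lemma integral_fracpart_unit (k : nat) : (0 < k)%N ->
  (\int[mu]_(t in `]k%:R, k.+1%:R]) (fracpart t / t)%:E = (unit_mass k)%:E)%E.
Proof.
move=> k0; have kR : 0 < k%:R :> R by rewrite ltr0n.
rewrite (@integral_real_eq_interior _ _ _ _ (fun t => 1 + - k%:R / t + 0 * t)).
- rewrite integral_inv_affine ?ltr_nat// /unit_mass; congr EFin.
  by rewrite -[in X in X - _]natr1; ring.
- exact: measurable_fracpart_div.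
- exact: measurable_inv_affine.
move=> t /andP[kt tk]; rewrite (@fracpart_itv _ k) ?(ltW kt)//.
by field; rewrite gt_eqF// (lt_trans kR).
Qed.

Lemma integral_cofracpart_unit (k : nat) : (0 < k)%N ->
  (\int[mu]_(t in `]k%:R, k.+1%:R]) ((1 - fracpart t) / t)%:E =
   (ln k.+1%:R - ln k%:R - unit_mass k)%:E)%E.
Proof.
move=> k0; have kR : 0 < k%:R :> R by rewrite ltr0n.
rewrite (@integral_real_eq_interior _ _ _ _ (fun t => -1 + k.+1%:R / t + 0 * t)).
- rewrite integral_inv_affine ?ltr_nat// /unit_mass; congr EFin.
  by rewrite -natr1; ring.
- exact: measurable_cofracpart_div.
- exact: measurable_inv_affine.
move=> t /andP[kt tk]; rewrite (@fracpart_itv _ k) ?(ltW kt)//.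
by rewrite -natr1; field; rewrite gt_eqF// (lt_trans kR).
Qed.

(** On the unit interval with midpoint [m = k + 1/2], replacing [1 / t] by
    [1 / m] in the sawtooth part [(t - m) / t] only errs by
    [(t - m)^2 / (t m)], and [t - m] has mean zero. The error is bounded by a
    difference [1 / k - 1 / (k + 1)] so that the bounds telescope. *)
Lemma unit_mass_bounds (k : nat) : (0 < k)%N ->
  (ln k.+1%:R - ln k%:R) / 2 - (k%:R^-1 - k.+1%:R^-1) / 2 <= unit_mass k
    <= (ln k.+1%:R - ln k%:R) / 2.
Proof.
move=> k0; have kR : 1 <= k%:R :> R by rewrite ler1n.
have kS : k.+1%:R = k%:R + 1 :> R by rewrite natr1.
set m : R := k%:R + 2^-1.
(* [U t = (1 / 2) / t + (t - m) / m], which integrates to half of the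
   logarithm. *)
pose U (t : R) := -1 + 2^-1 / t + m^-1 * t.
have IU : (\int[mu]_(t in `]k%:R, k.+1%:R]) (U t)%:E =
    ((ln k.+1%:R - ln k%:R) / 2)%:E)%E.
  rewrite integral_inv_affine ?ltr_nat//; last lra.
  by congr EFin; rewrite /m kS; field; lra.
pose f (t : R) := 1 + - k%:R / t + 0 * t.
(* [c = 1 / (2 k (k + 1))] dominates [(t - m)^2 / (t m)], as
   [(t - m)^2 <= 1/4] and [k (k + 1) <= 2 t m]. *)
pose c : R := (k%:R^-1 - k.+1%:R^-1) / 2.
pose g (t : R) := (1 + c) + - k%:R / t + 0 * t.
have fU (t : R) : k%:R < t -> U t - f t = (t - m) ^+ 2 / (t * m).
  by move=> kt; rewrite /U /f /m; field; lra.
have If : (\int[mu]_(t in `]k%:R, k.+1%:R]) (f t)%:E = (unit_mass k)%:E)%E.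
  rewrite integral_inv_affine ?ltr_nat//; last lra.
  by rewrite /unit_mass kS; congr EFin; ring.
have Ig : (\int[mu]_(t in `]k%:R, k.+1%:R]) (g t)%:E = (unit_mass k + c)%:E)%E.
  rewrite integral_inv_affine ?ltr_nat//; last lra.
  by rewrite /unit_mass kS; congr EFin; ring.
have f0 (t : R) : k%:R < t -> 0 <= f t.
  move=> kt; rewrite /f mul0r addr0 mulNr subr_ge0 ler_pdivrMr; lra.
have fleU (t : R) : k%:R < t -> f t <= U t.
  move=> kt; rewrite -subr_ge0 fU// divr_ge0 ?sqr_ge0//.
  by rewrite mulr_ge0 /m; lra.
apply/andP; split; last first.
  rewrite -lee_fin -If -IU; apply: integral_real_le => //.
  - exact: measurable_inv_affine.
  - exact: measurable_inv_affine.
  - by move=> t /=; rewrite in_itv/= => /andP[kt _]; exact: f0.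
  - by move=> t /=; rewrite in_itv/= => /andP[kt _]; exact: fleU.
rewrite lerBlDr -/c -lee_fin -Ig -IU; apply: integral_real_le => //.
- exact: measurable_inv_affine.
- exact: measurable_inv_affine.
- move=> t /=; rewrite in_itv/= => /andP[kt _].
  by apply: le_trans (fleU _ kt); exact: f0.
- move=> t /=; rewrite in_itv/= => /andP[kt tk].
  have -> : g t = f t + c by rewrite /g /f; ring.
  rewrite -lerBlDl fU//.
  have -> : c = (2 * k%:R * (k%:R + 1))^-1 by rewrite /c kS; field; lra.
  rewrite ler_pdivrMr; last by rewrite mulr_gt0 /m; lra.
  rewrite mulrC ler_pdivlMr; last by rewrite !mulr_gt0; lra.
  rewrite kS in tk.
  have h1 : (t - m) ^+ 2 <= 4^-1 by rewrite /m; nra.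
  have h2 : k%:R * (k%:R + 1) <= 2 * (t * m) by rewrite /m; nra.
  have h3 : 0 <= k%:R * (k%:R + 1) :> R by nra.
  nra.
Qed.

End Sawtooth.

Section LogarithmicGrowth.
Context {R : realType}.
Local Notation mu := (@lebesgue_measure R).
Implicit Types (T : R).

Lemma integral_fracpart_nat (n : nat) : (0 < n)%N ->
  exists s : R, [/\ (\int[mu]_(t in `]1%R, n%:R]) (fracpart t / t)%:E = s%:E)%E,
    (\int[mu]_(t in `]1%R, n%:R]) ((1 - fracpart t) / t)%:E =
     (ln n%:R - s)%:E)%E
    & ln n%:R / 2 - (1 - n%:R^-1) / 2 <= s <= ln n%:R / 2].
Proof.
have q0 (t : R) : 1 < t -> 0 <= fracpart t / t.
  by move=> t1; rewrite divr_ge0 ?fracpart_ge0//; lra.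
have q1 (t : R) : 1 < t -> 0 <= (1 - fracpart t) / t.
  by move=> t1; rewrite divr_ge0 ?subr_ge0 ?fracpart_le1//; lra.
elim: n => // -[_ _|n IH _].
  exists 0; rewrite set_itvoc0 !integral_set0 ln1 subr0.
  by split => //; apply/andP; split; lra.
have [s [I1 I2 /andP[s1 s2]]] := IH isT.
exists (s + unit_mass n.+1).
have n1 : 1 <= n.+1%:R :> R by rewrite ler1n.
have nn : n.+1%:R <= n.+2%:R :> R by rewrite ler_nat.
split.
- rewrite (integral_real_split (b := n.+1%:R)) ?bnd_simp//.
  + by rewrite I1 integral_fracpart_unit.
  + exact: measurable_fracpart_div.
  + by move=> t /=; rewrite in_itv/= => /andP[t1 _]; exact: q0.
- rewrite (integral_real_split (b := n.+1%:R)) ?bnd_simp//.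
  + rewrite I2 integral_cofracpart_unit// -EFinD; congr EFin; ring.
  + exact: measurable_cofracpart_div.
  + by move=> t /=; rewrite in_itv/= => /andP[t1 _]; exact: q1.
- have /andP[] := @unit_mass_bounds R n.+1 isT.
  move: s1 s2.
  set l1 := ln n.+1%:R; set l2 := ln n.+2%:R.
  set i1 := n.+1%:R^-1; set i2 := n.+2%:R^-1; set J := unit_mass _.
  move=> *. apply/andP; split; lra.
Qed.

Lemma ln2_le1 : ln (2 : R) <= 1.
Proof. by have -> : (2 : R) = 1 + 1 by []; apply: le_ln1Dx; lra. Qed.

(** Rounding [T] to an integer moves [ln T] by at most [ln 2 <= 1]. *)
Lemma ln_truncn T : 1 <= T -> exists n : nat,
  [/\ (0 < n)%N, n%:R <= T < n.+1%:R, ln n.+1%:R <= ln T + 1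
    & ln T <= ln n%:R + 1].
Proof.
move=> T1; exists (Num.truncn T).
have /andP[nT Tn] : (Num.truncn T)%:R <= T < (Num.truncn T).+1%:R.
  by apply: truncn_itv; lra.
have n0 : (0 < Num.truncn T)%N by rewrite truncn_gt0.
have n1 : 1 <= (Num.truncn T)%:R :> R by rewrite ler1n.
have nS : (Num.truncn T).+1%:R = (Num.truncn T)%:R + 1 :> R by rewrite natr1.
have l2 := ln2_le1.
split => //; first by rewrite nT.
- apply: (@le_trans _ _ (ln (T * 2))).
    by rewrite ler_ln ?posrE; lra.
  by rewrite lnM ?posrE; lra.
- apply: (@le_trans _ _ (ln ((Num.truncn T)%:R * 2))).
    by rewrite ler_ln ?posrE; lra.
  by rewrite lnM ?posrE; lra.
Qed.

Lemma integral_fracpart_div_le T : 1 <= T ->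
  (\int[mu]_(t in `]1%R, T]) (fracpart t / t)%:E <= (ln T / 2 + 2^-1)%:E)%E.
Proof.
move=> /ln_truncn[n [n0 /andP[_ Tn] ln1 _]].
have [s [I1 _ /andP[_ s2]]] := @integral_fracpart_nat n.+1 isT.
apply: (@le_trans _ _ s%:E); last by rewrite lee_fin; lra.
rewrite -I1; apply: integral_real_subset => //.
- exact: measurable_fracpart_div.
- move=> t /=; rewrite in_itv/= => /andP[t1 _].
  by rewrite divr_ge0 ?fracpart_ge0//; lra.
- by apply: subset_itvl; rewrite bnd_simp ltW.
Qed.

Lemma integral_fracpart_div_ge T : 1 <= T ->
  ((ln T / 2 - 1)%:E <= \int[mu]_(t in `]1%R, T]) (fracpart t / t)%:E)%E.
Proof.
move=> /ln_truncn[n [n0 /andP[nT _] _ ln1]].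
have [s [I1 _ /andP[s1 _]]] := integral_fracpart_nat n0.
have : 0 <= n%:R^-1 :> R by rewrite invr_ge0.
move=> ?; apply: (@le_trans _ _ s%:E); first by rewrite lee_fin; lra.
rewrite -I1; apply: integral_real_subset => //.
- exact: measurable_fracpart_div.
- move=> t /=; rewrite in_itv/= => /andP[t1 _].
  by rewrite divr_ge0 ?fracpart_ge0//; lra.
- by apply: subset_itvl; rewrite bnd_simp.
Qed.

Lemma integral_cofracpart_div_le T : 1 <= T ->
  (\int[mu]_(t in `]1%R, T]) ((1 - fracpart t) / t)%:E <= (ln T / 2 + 1)%:E)%E.
Proof.
move=> /ln_truncn[n [n0 /andP[_ Tn] ln1 _]].
have [s [_ I2 /andP[s1 _]]] := @integral_fracpart_nat n.+1 isT.
have : 0 <= n.+1%:R^-1 :> R by rewrite invr_ge0.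
move=> i0; apply: (@le_trans _ _ (ln n.+1%:R - s)%:E); last first.
  move: s1 ln1 i0; rewrite lee_fin.
  by set l := ln n.+1%:R; set i := n.+1%:R^-1 => *; lra.
rewrite -I2; apply: integral_real_subset => //.
- exact: measurable_cofracpart_div.
- move=> t /=; rewrite in_itv/= => /andP[t1 _].
  by rewrite divr_ge0 ?subr_ge0 ?fracpart_le1//; lra.
- by apply: subset_itvl; rewrite bnd_simp ltW.
Qed.

End LogarithmicGrowth.

(** * Weights truncated at 1/h *)

Section Increments.
Context {R : realType}.
Local Notation mu := (@lebesgue_measure R).
Implicit Types (h x y : R).

Lemma measurable_min1 h : measurable_fun setT (fun t : R => Num.min (h * t) 1).
Proof. by apply: measurable_minr => //; exact: measurable_funM. Qed.

Lemma min1_ge0 h (t : R) : 0 <= h -> 0 <= t -> 0 <= Num.min (h * t) 1.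
Proof. by move=> h0 t0; rewrite le_min mulr_ge0//= ler01. Qed.

Lemma measurable_min1_weight h (w : R -> R) : measurable_fun setT w ->
  measurable_fun setT (fun t : R => w t * Num.min (h * t) 1 * t ^- 2).
Proof.
move=> mw; apply: measurable_funM; last exact: measurable_invX.
by apply: measurable_funM => //; exact: measurable_min1.
Qed.

(** Only [1 < t <= 1/h] produces a logarithm: there the truncation is
    inactive, and beyond it the integral of [t^-2] is already [h]. *)
Lemma integral_min1_weight_le h (w : R -> R) : 0 < h -> h <= 1 ->
  measurable_fun setT w -> (forall t, 0 <= w t <= 1) ->
  (\int[mu]_(t in `]1%R, +oo[) (w t * Num.min (h * t) 1 * t ^- 2)%:E <=
   h%:E * \int[mu]_(t in `]1%R, (h^-1)%R]) (w t / t)%:E + h%:E)%E.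
Proof.
move=> h0 h1 mw w01.
have hV : 1 <= h^-1 by rewrite invf_ge1.
have w0 (t : R) : 0 <= w t by have /andP[] := w01 t.
have w1 (t : R) : w t <= 1 by have /andP[] := w01 t.
have mk := measurable_min1_weight h mw.
have k0 (t : R) : 0 <= t -> 0 <= w t * Num.min (h * t) 1 * t ^- 2.
  by move=> t0; rewrite !mulr_ge0 ?min1_ge0 ?invr_ge0 ?sqr_ge0// ltW.
rewrite (integral_real_split (b := h^-1)) ?bnd_simp//; last first.
  by move=> t /=; rewrite in_itv/= andbT => t1; apply: k0; lra.
apply: leeD.
  rewrite -integral_realZl//; last 3 first.
  - by apply: measurable_funM => //; exact: measurable_inv.
  - move=> t /=; rewrite in_itv/= => /andP[t1 _].
    by rewrite divr_ge0//; lra.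
  - exact: ltW.
  apply: integral_real_le => //.
  - apply: measurable_funM => //.
    by apply: measurable_funM => //; exact: measurable_inv.
  - by move=> t /=; rewrite in_itv/= => /andP[t1 _]; apply: k0; lra.
  - move=> t /=; rewrite in_itv/= => /andP[t1 _].
    have t0 : t != 0 by rewrite gt_eqF//; lra.
    have -> : h * (w t / t) = w t * (h * t) * t ^- 2 by field.
    rewrite ler_wpM2r ?invr_ge0 ?sqr_ge0//.
    by rewrite ler_wpM2l// ge_min lexx.
rewrite -[X in (_ <= X%:E)%E]invrK -integral_invX2_tail ?invr_gt0//.
apply: integral_real_le => //.
- exact: measurable_invX.
- by move=> t /=; rewrite in_itv/= andbT => t1; apply: k0; lra.
- move=> t /=; rewrite in_itv/= andbT => t1.
  rewrite ler_piMl ?invr_ge0 ?sqr_ge0//.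
  have tp : 0 <= t by lra.
  have h0' := ltW h0.
  by rewrite mulr_ile1 ?min1_ge0// ge_min lexx orbT.
Qed.

Lemma integral_cst_unit (c : R) : 0 <= c ->
  (\int[mu]_(t in `]0%R, 1%R]) c%:E = c%:E)%E.
Proof.
move=> c0; rewrite integral_cst//= lebesgue_measure_itv/= lte_fin ltr01.
by rewrite -EFinB subr0 mule1.
Qed.

(** An upper bound for the increase of the autocorrelation over a step [h]. *)
Definition excess h : \bar R :=
  (\int[mu]_(t in `]0%R, +oo[) (fracpart t * Num.min (h * t) 1 * t ^- 2)%:E)%E.

(** The price, in a decrease over a step [h], of replacing the weight [{t}] by
    [1] on [(1, oo)]. *)
Definition coexcess h : \bar R :=
  (\int[mu]_(t in `]1%R, +oo[)
     ((1 - fracpart t) * Num.min (h * t) 1 * t ^- 2)%:E)%E.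

Lemma excess_le h : 0 < h -> h <= 1 ->
  (excess h <= (2^-1 * h * ln h^-1 + 3 * h)%:E)%E.
Proof.
move=> h0 h1; rewrite /excess.
have hV : 1 <= h^-1 by rewrite invf_ge1.
have mk := measurable_min1_weight h (@measurable_fracpart R).
have k0 (t : R) : 0 < t -> 0 <= fracpart t * Num.min (h * t) 1 * t ^- 2.
  move=> t0; rewrite !mulr_ge0 ?fracpart_ge0 ?min1_ge0 ?invr_ge0 ?sqr_ge0//;
  exact: ltW.
rewrite (integral_real_split (b := 1)) ?bnd_simp//; last first.
  by move=> t /=; rewrite in_itv/= andbT; exact: k0.
apply: (@le_trans _ _
  (h%:E + (h%:E * (ln h^-1 / 2 + 2^-1)%:E + h%:E))%E); last first.
  by rewrite -EFinM -!EFinD lee_fin; lra.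
apply: leeD.
  rewrite -(integral_cst_unit (ltW h0)); apply: integral_real_le => //.
  - by move=> t /=; rewrite in_itv/= => /andP[t0 _]; exact: k0.
  - move=> t /=; rewrite in_itv/= => /andP[t0 _].
    rewrite ler_pdivrMr ?exprn_gt0//.
    have -> : h * t ^+ 2 = t * (h * t) by ring.
    by rewrite ler_pM ?fracpart_ge0 ?fracpart_le ?min1_ge0 ?ge_min ?lexx// ltW.
apply: (le_trans (integral_min1_weight_le h0 h1 (@measurable_fracpart R) _)).
  by move=> t; rewrite fracpart_ge0 fracpart_le1.
by rewrite leeD2r// lee_pmul2l ?lte_fin// integral_fracpart_div_le.
Qed.

Lemma coexcess_le h : 0 < h -> h <= 1 ->
  (coexcess h <= (2^-1 * h * ln h^-1 + 2 * h)%:E)%E.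
Proof.
move=> h0 h1; rewrite /coexcess.
have hV : 1 <= h^-1 by rewrite invf_ge1.
apply: (le_trans (integral_min1_weight_le h0 h1 (@measurable_cofracpart R) _)).
  by move=> t; rewrite subr_ge0 fracpart_le1 gerBl fracpart_ge0.
apply: (@le_trans _ _ (h%:E * (ln h^-1 / 2 + 1)%:E + h%:E)%E); last first.
  by rewrite -EFinM -!EFinD lee_fin; lra.
by rewrite leeD2r// lee_pmul2l ?lte_fin// integral_cofracpart_div_le.
Qed.

End Increments.

(** * Increments of the autocorrelation *)

Section Autocorrelation.
Context {R : realType}.
Local Notation mu := (@lebesgue_measure R).
Implicit Types (h x y : R) (D : set R).

(** The autocorrelation integral over a part of the half-line, in extended
    reals so that parts can be added and compared before finiteness is known. *)
Definition corr_integral D x : \bar R :=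
  (\int[mu]_(t in D) (fracpart t * fracpart (x * t) * t ^- 2)%:E)%E.

Lemma measurable_corr x :
  measurable_fun setT (fun t : R => fracpart t * fracpart (x * t) * t ^- 2).
Proof.
apply: measurable_funM; last exact: measurable_invX.
apply: measurable_funM; first exact: measurable_fracpart.
exact: measurable_fracpartM.
Qed.

Lemma corr_ge0 x (t : R) : 0 <= fracpart t * fracpart (x * t) * t ^- 2.
Proof. by rewrite !mulr_ge0 ?fracpart_ge0// invr_ge0 sqr_ge0. Qed.

Lemma fracpartM_increment h x y (t : R) : x <= y -> y <= x + h -> 0 <= t ->
  fracpart (y * t) <= fracpart (x * t) + Num.min (h * t) 1.
Proof.
move=> xy yh t0; have -> : y * t = x * t + (y - x) * t by ring.
apply: le_trans (fracpartD _ _) _; first by rewrite mulr_ge0// subr_ge0.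
rewrite lerD2l le_min !ge_min lexx orbT andbT.
by rewrite ler_wpM2r//; lra.
Qed.

Lemma corr_increase h x y : 0 <= h -> x <= y -> y <= x + h ->
  (corr_integral `]0%R, +oo[ y <= corr_integral `]0%R, +oo[ x + excess h)%E.
Proof.
move=> h0 xy yh; have mk := measurable_min1_weight h (@measurable_fracpart R).
have mx := measurable_corr x.
rewrite /corr_integral /excess -integral_realD//; last 2 first.
- by move=> t _; exact: corr_ge0.
- move=> t /=; rewrite in_itv/= andbT => t0.
  by rewrite !mulr_ge0 ?fracpart_ge0 ?min1_ge0 ?invr_ge0 ?sqr_ge0// ltW.
apply: integral_real_le => //; [exact: measurable_corr|exact: measurable_funD|..].
- by move=> t _; exact: corr_ge0.
- move=> t /=; rewrite in_itv/= andbT => t0.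
  rewrite -mulrDl -mulrDr ler_wpM2r ?invr_ge0 ?sqr_ge0//.
  rewrite ler_wpM2l ?fracpart_ge0//; apply: fracpartM_increment => //.
  exact: ltW.
Qed.

(** On [(0, 1)] we have [{t} = t], and dilating by [x] turns the integral into
    that of [{u} / u] over [(0, x)]. *)
Lemma corr_near x : 0 < x -> (corr_integral `]0%R, 1%R] x =
  \int[mu]_(u in `]0%R, x[) (fracpart u / u)%:E)%E.
Proof.
move=> x0.
have mf : measurable_fun setT (fun t : R => fracpart (x * t) / (x * t)).
  apply: (measurableT_comp measurable_fracpart_div); exact: measurable_funM.
have f0 (t : R) : 0 < t -> 0 <= fracpart t / t.
  by move=> t0; rewrite divr_ge0 ?fracpart_ge0// ltW.
rewrite (integral_dilate x0)//; last 2 first.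
- exact: measurable_fracpart_div.
- by move=> t /=; rewrite in_itv/= => /andP[t0 _]; exact: f0.
have -> : (fun t => x * t) @^-1` `]0, x[ = `]0, 1[%classic.
  have xE t : (x * t < x) = (t < 1) by rewrite -[X in _ < X]mulr1 ltr_pM2l.
  by apply/seteqP; split => t /=; rewrite !in_itv/= pmulr_rgt0// xE.
rewrite -integral_realZl//; last 2 first.
- move=> t /=; rewrite in_itv/= => /andP[t0 _]; apply: f0.
  by rewrite mulr_gt0.
- exact: ltW.
rewrite /corr_integral integral_itv_bndoo; last first.
  by apply/measurable_EFinP; apply: measurable_funTS; exact: measurable_corr.
apply: eq_integral => t /[!inE]/=; rewrite in_itv/= => /andP[t0 t1].
have -> : fracpart t = t.
  by rewrite (@fracpart_itv _ 0) ?subr0// t1 ltW.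
by congr EFin; field; rewrite !gt_eqF.
Qed.

Lemma corr0 D : (corr_integral D 0 = 0)%E.
Proof.
rewrite /corr_integral; apply: integral0_eq => t _.
by rewrite mul0r fracpart0 mulr0 mul0r.
Qed.

Lemma corr_near_le x y : 0 <= x -> x <= y ->
  (corr_integral `]0%R, 1%R] x <= corr_integral `]0%R, 1%R] y)%E.
Proof.
rewrite le_eqVlt => /predU1P[<- _|x0 xy].
  by rewrite corr0; apply: integral_real_ge0 => t _; exact: corr_ge0.
rewrite !corr_near//; last exact: lt_le_trans xy.
apply: integral_real_subset => //.
- exact: measurable_fracpart_div.
- move=> t /=; rewrite in_itv/= => /andP[t0 _].
  by rewrite divr_ge0 ?fracpart_ge0// ltW.
- by apply: subset_itvl; rewrite bnd_simp.
Qed.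

(** The integral over [(1, oo)] with the weight [{t}] replaced by [1]. *)
Definition far_integral x : \bar R :=
  (\int[mu]_(t in `]1%R, +oo[) (fracpart (x * t) * t ^- 2)%:E)%E.

Lemma measurable_far x :
  measurable_fun setT (fun t : R => fracpart (x * t) * t ^- 2).
Proof.
by apply: measurable_funM; [exact: measurable_fracpartM|exact: measurable_invX].
Qed.

Lemma far_ge0 x (t : R) : 0 <= fracpart (x * t) * t ^- 2.
Proof. by rewrite mulr_ge0 ?fracpart_ge0// invr_ge0 sqr_ge0. Qed.

Lemma far_integral_le1 x : (far_integral x <= 1%:E)%E.
Proof.
rewrite -[X in (_ <= X%:E)%E]invr1 -integral_invX2_tail//.
apply: integral_real_le => //.
- exact: measurable_far.
- exact: measurable_invX.
- by move=> t _; exact: far_ge0.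
- by move=> t _; rewrite ler_piMl ?fracpart_le1// invr_ge0 sqr_ge0.
Qed.

Lemma measurable_fracpart_invX2 :
  measurable_fun setT (fun t : R => fracpart t * t ^- 2).
Proof.
by apply: measurable_funM; [exact: measurable_fracpart|exact: measurable_invX].
Qed.

Lemma fracpart_invX2_ge0 (t : R) : 0 <= fracpart t * t ^- 2.
Proof. by rewrite mulr_ge0 ?fracpart_ge0// invr_ge0 sqr_ge0. Qed.

Lemma far_integral_dilate x : 0 < x ->
  (far_integral x = x%:E * \int[mu]_(u in `]x, +oo[) (fracpart u * u ^- 2)%:E)%E.
Proof.
move=> x0.
have mf := measurable_fracpart_invX2; have f0 := fracpart_invX2_ge0.
have mfx : measurable_fun setT (fun t : R => fracpart (x * t) * (x * t) ^- 2).
  by apply: (measurableT_comp mf); exact: measurable_funM.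
rewrite (integral_dilate x0)//.
have -> : (fun t => x * t) @^-1` `]x, +oo[ = `]1, +oo[%classic.
  have xE t : (x < x * t) = (1 < t) by rewrite -[X in X < _]mulr1 ltr_pM2l.
  by apply/seteqP; split => t /=; rewrite !in_itv/= !andbT xE.
rewrite -integral_realZl//; last exact: ltW.
rewrite -integral_realZl//; last 3 first.
- exact: measurable_funM.
- by move=> t _; rewrite mulr_ge0// ltW.
- exact: ltW.
apply: eq_integral => t /[!inE]/=; rewrite in_itv/= andbT => t1.
congr EFin; field; rewrite !gt_eqF//; lra.
Qed.

(** Writing [B x = x * \int_x^oo {u} / u^2], the passage from [y] to a smaller
    [x] loses in the factor and gains at most [x * \int_x^y du / u <= y - x] in
    the range of integration, because [{u} <= u] and [x <= u]. *)
Lemma far_integral_decrease x y : 0 <= x -> x <= y ->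
  (far_integral x <= far_integral y + (y - x)%:E)%E.
Proof.
rewrite le_eqVlt => /predU1P[<- xy|x0 xy].
  rewrite {1}/far_integral (integral0_eq _); last first.
    by move=> t _; rewrite mul0r fracpart0 mul0r.
  rewrite adde_ge0//; last by rewrite lee_fin subr_ge0.
  by apply: integral_real_ge0 => t _; exact: far_ge0.
have y0 : 0 < y by exact: lt_le_trans xy.
have mf := measurable_fracpart_invX2; have f0 := fracpart_invX2_ge0.
rewrite !far_integral_dilate// (integral_real_split (b := y)) ?bnd_simp//.
rewrite ge0_muleDr; try by apply: integral_real_ge0.
rewrite addeC leeD//.
  by rewrite lee_wpmul2r ?lee_fin//; apply: integral_real_ge0.
have -> : ((y - x)%:E = x%:E * \int[mu]_(t in `]x, y]) (x^-1)%:E)%E.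
  rewrite integral_cst//= lebesgue_measure_itv/= lte_fin.
  case: ltgtP xy => // [xy _|-> _]; last by rewrite subrr !mule0.
  by rewrite -EFinB -!EFinM mulrA divff ?mul1r// gt_eqF.
rewrite lee_pmul2l ?lte_fin//; apply: integral_real_le => //.
move=> t /=; rewrite in_itv/= => /andP[xt _].
have t0 : 0 < t by lra.
apply: (@le_trans _ _ (t * t ^- 2)).
  by rewrite ler_wpM2r ?invr_ge0 ?sqr_ge0// fracpart_le// ltW.
have -> : t * t ^- 2 = t^-1 by field; rewrite gt_eqF.
by rewrite lef_pV2 ?posrE// ltW.
Qed.

(** Beyond [1] the weight [{t}] is traded for the constant weight [1]:
    [{t} d <= d + (1 - {t}) e] whenever [- d <= e], applied with
    [d = {x t} - {y t}] and [e = min (h t) 1]. *)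
Lemma corr_far_decrease h x y : 0 <= h -> x <= y -> y <= x + h ->
  (corr_integral `]1%R, +oo[ x + far_integral y <=
   corr_integral `]1%R, +oo[ y + far_integral x + coexcess h)%E.
Proof.
move=> h0 xy yh.
have mk := measurable_min1_weight h (@measurable_cofracpart R).
have mcx := measurable_corr x; have mcy := measurable_corr y.
have mfx := measurable_far x; have mfy := measurable_far y.
have c0 := corr_ge0; have f0 := far_ge0.
have k0 (t : R) : 1 < t -> 0 <= (1 - fracpart t) * Num.min (h * t) 1 * t ^- 2.
  move=> t1; rewrite !mulr_ge0 ?subr_ge0 ?fracpart_le1 ?invr_ge0 ?sqr_ge0//.
  by rewrite min1_ge0//; lra.
rewrite /corr_integral /far_integral /coexcess.
rewrite -!integral_realD//; last 3 first.
- exact: measurable_funD.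
- by move=> t _; rewrite addr_ge0.
- by move=> t /=; rewrite in_itv/= andbT; exact: k0.
apply: integral_real_le => //.
- exact: measurable_funD.
- by do 2 apply: measurable_funD => //.
- by move=> t _; rewrite addr_ge0.
- move=> t /=; rewrite in_itv/= andbT => t1.
  rewrite -!mulrDl ler_wpM2r ?invr_ge0 ?sqr_ge0//.
  have t0 : 0 <= t by lra.
  have := fracpartM_increment xy yh t0.
  have := fracpart_le1 t.
  by nra.
Qed.

Lemma corr_integral_split x : (corr_integral `]0%R, +oo[ x =
  corr_integral `]0%R, 1%R] x + corr_integral `]1%R, +oo[ x)%E.
Proof.
rewrite /corr_integral (integral_real_split (b := 1)) ?bnd_simp//.
- exact: measurable_corr.
- by move=> t _; exact: corr_ge0.
Qed.

Lemma corr_decrease h x y : 0 <= h -> 0 <= x -> x <= y -> y <= x + h ->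
  (corr_integral `]0%R, +oo[ x <=
   corr_integral `]0%R, +oo[ y + (coexcess h + h%:E))%E.
Proof.
move=> h0 x0 xy yh.
have By0 : (0 <= far_integral y)%E.
  by apply: integral_real_ge0 => t _; exact: far_ge0.
have Byfin : far_integral y \is a fin_num.
  by rewrite ge0_fin_numE// (le_lt_trans (far_integral_le1 y))// ltry.
rewrite (corr_integral_split x) (corr_integral_split y) -[leRHS]addeA.
apply: leeD; first exact: corr_near_le.
rewrite -(leeD2rE _ _ Byfin).
apply: le_trans (corr_far_decrease h0 xy yh) _.
have yxh : ((y - x)%:E <= h%:E)%E by rewrite lee_fin; lra.
have := le_trans (far_integral_decrease x0 xy) (leeD2l (far_integral y) yxh).
move: (corr_integral _ y) (far_integral x) (far_integral y) (coexcess h).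
move=> cy fx fy k fxy; rewrite -[leLHS]addeA -[leRHS]addeA leeD2l//.
by rewrite addeC -addeA leeD2l// addeC.
Qed.

Lemma corr_integral_fin x : 0 <= x -> corr_integral `]0%R, +oo[ x \is a fin_num.
Proof.
move=> x0; rewrite ge0_fin_numE; last first.
  by apply: integral_real_ge0 => t _; exact: corr_ge0.
rewrite corr_integral_split; apply: lte_add_pinfty.
  apply: (@le_lt_trans _ _ x%:E); last exact: ltry.
  rewrite -(integral_cst_unit x0); apply: integral_real_le => //.
  - exact: measurable_corr.
  - by move=> t _; exact: corr_ge0.
  - move=> t /=; rewrite in_itv/= => /andP[t0 _].
    rewrite ler_pdivrMr ?exprn_gt0//.
    have -> : x * t ^+ 2 = t * (x * t) by ring.
    by rewrite ler_pM ?fracpart_ge0 ?fracpart_le ?mulr_ge0// ltW.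
apply: (@le_lt_trans _ _ 1%:E); last exact: ltry.
apply: le_trans (far_integral_le1 x); apply: integral_real_le => //.
- exact: measurable_corr.
- exact: measurable_far.
- by move=> t _; exact: corr_ge0.
- move=> t _; rewrite -mulrA ler_piMl ?fracpart_le1//.
  exact: far_ge0.
Qed.

Lemma autocorrE x : 0 <= x -> (autocorr x)%:E = corr_integral `]0%R, +oo[ x.
Proof. by move=> x0; rewrite /autocorr /Rintegral fineK// corr_integral_fin. Qed.

Lemma autocorr_increment h x y : 0 < h -> h <= 1 ->
  0 <= x -> x <= y -> y <= x + h ->
  `|autocorr x - autocorr y| <= 2^-1 * h * ln h^-1 + 3 * h.
Proof.
move=> h0 h1 x0 xy yh; have h0' := ltW h0; have y0 := le_trans x0 xy.
rewrite ler_distl; apply/andP; split.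
  rewrite lerBlDr -lee_fin EFinD !autocorrE//.
  apply: le_trans (corr_increase h0' xy yh) _.
  by rewrite leeD2l// excess_le.
rewrite -lee_fin EFinD !autocorrE//.
apply: le_trans (corr_decrease h0' x0 xy yh) _.
rewrite leeD2l//.
apply: (@le_trans _ _ ((2^-1 * h * ln h^-1 + 2 * h)%:E + h%:E)%E).
  by rewrite leeD2r// coexcess_le.
by rewrite -EFinD lee_fin; lra.
Qed.

(** For [1 < t < 1/h] the integrand is [{t} (h t) / t^2 = h {t} / t]. *)
Lemma autocorr_ge h : 0 < h -> h <= 1 ->
  2^-1 * h * ln h^-1 - h <= autocorr h.
Proof.
move=> h0 h1; have hV : 1 <= h^-1 by rewrite invf_ge1.
have q0 (t : R) : 1 < t -> 0 <= fracpart t / t.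
  by move=> t1; rewrite divr_ge0 ?fracpart_ge0//; lra.
rewrite -lee_fin autocorrE; last exact: ltW.
apply: (@le_trans _ _ (h%:E * (ln h^-1 / 2 - 1)%:E)%E).
  by rewrite -EFinM lee_fin; lra.
apply: (@le_trans _ _
  (h%:E * \int[mu]_(t in `]1%R, (h^-1)%R]) (fracpart t / t)%:E)%E).
  by rewrite lee_pmul2l ?lte_fin// integral_fracpart_div_ge.
rewrite -integral_realZl//; last 3 first.
- exact: measurable_fracpart_div.
- by move=> t /=; rewrite in_itv/= => /andP[t1 _]; exact: q0.
- exact: ltW.
apply: (@le_trans _ _ (corr_integral `]1%R, (h^-1)%R] h)).
  rewrite le_eqVlt; apply/orP; left; apply/eqP.
  apply: integral_real_eq_interior.
  - by apply: measurable_funM => //; exact: measurable_fracpart_div.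
  - exact: measurable_corr.
  move=> t /andP[t1 th].
  have ht : h * t < 1 by rewrite mulrC -ltr_pdivlMr// div1r.
  rewrite (@fracpart_itv _ 0 (h * t)) ?subr0; last first.
    by rewrite ht andbT mulr_ge0//; lra.
  by field; rewrite gt_eqF//; lra.
apply: integral_real_subset => //.
- exact: measurable_corr.
- by move=> t _; exact: corr_ge0.
- by move=> t /=; rewrite !in_itv/= andbT => /andP[t1 _]; lra.
Qed.

End Autocorrelation.

Unset Implicit Arguments.
Set Strict Implicit.

Theorem proposition31 (R : realType) :
  exists C : R, forall h : R, 0 < h -> h <= 1 ->
    (`| modulus (@autocorr R) h - (2^-1 * h * ln (h^-1))%:E | <= (C * h)%:E)%E.
Proof.
(* 3 is the constant of [excess_le], and of [coexcess_le] once the loss [h] of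
   [far_integral_decrease] is added. *)
exists 3 => h h0 h1.
have A0 : autocorr (0 : R) = 0.
  by apply: EFin_inj; rewrite autocorrE// corr0.
have up : (modulus (@autocorr R) h <= (2^-1 * h * ln h^-1 + 3 * h)%:E)%E.
  apply: ub_ereal_sup => _ [[x y] /= [x0 y0 xy] <-]; rewrite lee_fin.
  move: xy; rewrite ler_distl => /andP[xy yx].
  have [le|le] := leP x y.
    by apply: autocorr_increment => //; lra.
  by rewrite distrC; apply: autocorr_increment => //; lra.
have low : ((2^-1 * h * ln h^-1 - h)%:E <= modulus (@autocorr R) h)%E.
  apply: (@le_trans _ _ `|autocorr h - autocorr 0|%:E).
    rewrite lee_fin A0 subr0 (le_trans (autocorr_ge h0 h1))//.
    exact: ler_norm.
  apply: ereal_sup_ubound; exists (h, 0) => //=.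
  by split => //; [exact: ltW|rewrite subr0 ger0_norm// ltW].
move: up low; case: (modulus _ _) => [r| |]//; rewrite !lee_fin => up low.
by rewrite ler_norml; apply/andP; split; lra.
Qed.
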